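(* Let $\rho:\Gamma_{\mathrm{cube}}\to\mathrm{Isom}(\mathbb A\mathrm d\mathbb S^4)$ be a representation whose image is a cusp group. Then there is a neighbourhood of $\rho$ in $\mathrm{Hom}(\Gamma_{\mathrm{cube}},\mathrm{Isom}(\mathbb A\mathrm d\mathbb S^4))$ such that the image of every representation in this neighbourhood is a cusp group.
   Context: Let $q_{-1}(x)=-x_0^2+x_1^2+x_2^2+x_3^2-x_4^2$ on $\mathbb R^5$ with bilinear form $b_{-1}$. $\mathbb A\mathrm d\mathbb S^4=\{q_{-1}=-1\}$, $\mathrm{Isom}(\mathbb A\mathrm d\mathbb S^4)=\mathrm O(q_{-1})$, and $\partial\mathbb A\mathrm d\mathbb S^4=\{x\ne0: q_{-1}(x)=0\}/\mathbb R_{>0}$, both viewed in the projective sphere $(\mathbb R^5\smallsetminus\{0\})/\mathbb R_{>0}$. A hyperplane is the intersection of $\mathbb A\mathrm d\mathbb S^4$ with a linear hyperplane of $\mathbb R^5$; it is asymptotic to a point $p\in\partial\mathbb A\mathrm d\mathbb S^4$ if $p$ lies in its closure in the projective sphere. A reflection is a non-trivial involution in $\mathrm{Isom}(\mathbb A\mathrm d\mathbb S^4)$ fixing a hyperplane pointwise; it is $r_X$ for some $X$ with $q_{-1}(X)=\pm1$, where $r_X$ is $-1$ on $X$ and the identity on the $b_{-1}$-orthogonal of $X$. $\Gamma_{\mathrm{cube}}$ is the right-angled Coxeter group generated by the reflections in the faces of a Euclidean cube: six generators of order two, one per face; generators of adjacent faces commute ($12$ relations); no relation between opposite faces. The image of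 a representation $\Gamma_{\mathrm{cube}}\to\mathrm{Isom}(\mathbb A\mathrm d\mathbb S^4)$ is called a cusp group if the six generators are sent to reflections in six distinct hyperplanes asymptotic to a common point at infinity. *)

(* Defs.v *)
From HB Require Import structures.
From mathcomp Require Import all_boot all_order all_algebra.
From mathcomp Require Import all_classical all_reals all_analysis.
From mathcomp Require Import ring lra.

Set Implicit Arguments.
Unset Strict Implicit.
Unset Printing Implicit Defensive.

Import Order.TTheory GRing.Theory Num.Theory.
Import numFieldNormedType.Exports.

Local Open Scope classical_set_scope.
Local Open Scope ring_scope.
Local Open Scope quotient_scope.

(* The face (k, e) of the cube is the one on which the k-th coordinate takes
   its extreme value indexed by e. *)
Definition face : Type := ('I_3 * bool)%type.

Definition adjacent (s t : face) : bool := s.1 != t.1.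

(* Generators are involutions, so words in the generators (without formal
   inverses) modulo the congruence generated by the relations already form
   the group presented by these generators and relations. *)
Inductive cube_congr : seq face -> seq face -> Prop :=
| cube_congr_refl w : cube_congr w w
| cube_congr_sym w1 w2 : cube_congr w1 w2 -> cube_congr w2 w1
| cube_congr_trans w1 w2 w3 :
    cube_congr w1 w2 -> cube_congr w2 w3 -> cube_congr w1 w3
| cube_congr_cat w1 w1' w2 w2' :
    cube_congr w1 w1' -> cube_congr w2 w2' ->
    cube_congr (w1 ++ w2) (w1' ++ w2')
| cube_congr_square s : cube_congr [:: s; s] [::]
| cube_congr_comm s t : adjacent s t -> cube_congr [:: s; t] [:: t; s].

Definition cube_congrb : rel (seq face) := fun w1 w2 => `[< cube_congr w1 w2 >].

Lemma cube_congrb_refl : reflexive cube_congrb.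
Proof. by move=> w; apply/asboolP; exact: cube_congr_refl. Qed.

Lemma cube_congrb_sym : symmetric cube_congrb.
Proof. by move=> v w; apply/asboolP/asboolP; exact: cube_congr_sym. Qed.

Lemma cube_congrb_trans : transitive cube_congrb.
Proof.
move=> w2 w1 w3 /asboolP h12 /asboolP h23; apply/asboolP.
exact: cube_congr_trans h12 h23.
Qed.

Canonical cube_equiv :=
  EquivRel cube_congrb cube_congrb_refl cube_congrb_sym cube_congrb_trans.

Definition Gamma_cube : Type := {eq_quot cube_equiv}.

HB.instance Definition _ := EqQuotient.on Gamma_cube.
HB.instance Definition _ := Choice.on Gamma_cube.

Definition cube_word (w : seq face) : Gamma_cube := \pi_Gamma_cube w.

Definition cube_gen (s : face) : Gamma_cube := cube_word [:: s].

Definition cube_one : Gamma_cube := cube_word [::].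

Definition cube_mul (g h : Gamma_cube) : Gamma_cube :=
  cube_word (repr g ++ repr h).

Definition cube_inv (g : Gamma_cube) : Gamma_cube := cube_word (rev (repr g)).

Lemma cube_wordP (v w : seq face) :
  cube_word v = cube_word w <-> cube_congr v w.
Proof.
by split=> [/eqmodP/asboolP //|h]; apply/eqmodP/asboolP.
Qed.

Lemma cube_wordK (g : Gamma_cube) : cube_word (repr g) = g.
Proof. exact: reprK. Qed.

Lemma cube_wordM (v w : seq face) :
  cube_mul (cube_word v) (cube_word w) = cube_word (v ++ w).
Proof.
by apply/cube_wordP; apply: cube_congr_cat; apply/cube_wordP; exact: cube_wordK.
Qed.

Lemma cube_congr_rev (w : seq face) : cube_congr (rev w ++ w) [::].
Proof.
elim: w => [|s w IHw]; first exact: cube_congr_refl.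
rewrite rev_cons -cats1 -catA /=; apply: cube_congr_trans IHw.
apply: cube_congr_cat; first exact: cube_congr_refl.
rewrite -[s :: s :: w]/([:: s; s] ++ w) -[X in cube_congr _ X]cat0s.
by apply: cube_congr_cat; [exact: cube_congr_square | exact: cube_congr_refl].
Qed.

Lemma cube_mulA : associative cube_mul.
Proof.
move=> f g h; rewrite -(cube_wordK f) -(cube_wordK g) -(cube_wordK h).
by rewrite !cube_wordM catA.
Qed.

Lemma cube_mul1g : left_id cube_one cube_mul.
Proof. by move=> g; rewrite -(cube_wordK g) cube_wordM. Qed.

Lemma cube_mulg1 : right_id cube_one cube_mul.
Proof. by move=> g; rewrite -(cube_wordK g) cube_wordM cats0. Qed.

Lemma cube_mulVg : left_inverse cube_one cube_inv cube_mul.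
Proof.
move=> g; rewrite -{2}(cube_wordK g) cube_wordM.
by apply/cube_wordP; exact: cube_congr_rev.
Qed.

Lemma cube_mulgV : right_inverse cube_one cube_inv cube_mul.
Proof.
move=> g; rewrite -{1}(cube_wordK g) cube_wordM.
by apply/cube_wordP; rewrite -{1}(revK (repr g)); exact: cube_congr_rev.
Qed.

HB.instance Definition _ := isGroup.Build Gamma_cube
  cube_mulA cube_mul1g cube_mulg1 cube_mulVg cube_mulgV.

Section AdS.
Variable R : realType.

Local Notation vec := 'cV[R]_5.

Definition coord5 (x : vec) (i : nat) : R := x (inord i) 0.

Definition b_AdS (x y : vec) : R :=
  - (coord5 x 0 * coord5 y 0) + coord5 x 1 * coord5 y 1
  + coord5 x 2 * coord5 y 2 + coord5 x 3 * coord5 y 3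
  - coord5 x 4 * coord5 y 4.

Definition q_AdS (x : vec) : R := b_AdS x x.

Definition AdS4 : set vec := [set x | q_AdS x = -1].

Definition O_AdS : set 'M[R]_5 := [set A | forall x, q_AdS (A *m x) = q_AdS x].

Definition IsomAdS : Type := set_type O_AdS.

(* The subspace topology inherited from the space of matrices. *)
HB.instance Definition _ := Topological.copy IsomAdS (set_type O_AdS).

Lemma b_AdS_polar (x y : vec) :
  b_AdS x y *+ 2 = q_AdS (x + y) - q_AdS x - q_AdS y.
Proof. by rewrite /q_AdS /b_AdS /coord5 !mxE; ring. Qed.

Lemma b_AdS_nondegenerate (x : vec) : (forall y, b_AdS x y = 0) -> x = 0.
Proof.
move=> bx0; apply/colP => i; rewrite mxE.
have := bx0 (delta_mx i 0); rewrite /b_AdS /coord5 !mxE !eqxx !andbT.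
rewrite -(inord_val i) -!val_eqE /= !inordK //.
by case: (nat_of_ord i) (ltn_ord i) => [|[|[|[|[|]]]]] //= _; rewrite ?inordK //=; lra.
Qed.

Lemma O_AdS_unit (A : 'M[R]_5) : O_AdS A -> A \in unitmx.
Proof.
move=> OA; rewrite -unitmx_tr -row_free_unit -kermx_eq0.
apply/eqP/row_matrixP => i; rewrite row0.
set u := row i _; have uA0 : u *m A^T = 0.
  by rewrite /u -row_mul mulmx_ker row0.
have Au0 : A *m u^T = 0 by rewrite -[A]trmxK -trmx_mul uA0 trmx0.
suff : u^T = 0 by move/(congr1 trmx); rewrite trmxK trmx0.
have q0 : q_AdS 0 = 0 by rewrite /q_AdS /b_AdS /coord5 !mxE; ring.
apply: b_AdS_nondegenerate => y.
have /eqP : b_AdS u^T y *+ 2 = 0.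
  rewrite b_AdS_polar -(OA (_ + _)) -(OA u^T) -(OA y) mulmxDr Au0 add0r q0.
  by rewrite subr0 subrr.
by rewrite mulrn_eq0 /= => /eqP.
Qed.

Lemma O_AdS1 : O_AdS 1%:M.
Proof. by move=> x; rewrite mul1mx. Qed.

Lemma O_AdSM (A B : 'M[R]_5) : O_AdS A -> O_AdS B -> O_AdS (A *m B).
Proof. by move=> OA OB x; rewrite -mulmxA OA OB. Qed.

Lemma O_AdSV (A : 'M[R]_5) : O_AdS A -> O_AdS (invmx A).
Proof. by move=> OA x; rewrite -(OA (_ *m x)) mulKVmx ?O_AdS_unit. Qed.

Definition isom_one : IsomAdS := SigSub (mem_set O_AdS1).

Definition isom_mul (A B : IsomAdS) : IsomAdS :=
  SigSub (mem_set (O_AdSM (set_valP A) (set_valP B))).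

Definition isom_inv (A : IsomAdS) : IsomAdS :=
  SigSub (mem_set (O_AdSV (set_valP A))).

Lemma isom_mulA : associative isom_mul.
Proof. by move=> A B C; apply: val_inj; rewrite /= mulmxA. Qed.

Lemma isom_mul1g : left_id isom_one isom_mul.
Proof. by move=> A; apply: val_inj; rewrite /= mul1mx. Qed.

Lemma isom_mulg1 : right_id isom_one isom_mul.
Proof. by move=> A; apply: val_inj; rewrite /= mulmx1. Qed.

Lemma isom_mulVg : left_inverse isom_one isom_inv isom_mul.
Proof.
move=> A; apply: val_inj => /=.
by rewrite mulVmx // O_AdS_unit //; exact: set_valP.
Qed.

Lemma isom_mulgV : right_inverse isom_one isom_inv isom_mul.
Proof.
move=> A; apply: val_inj => /=.
by rewrite mulmxV // O_AdS_unit //; exact: set_valP.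
Qed.

HB.instance Definition _ := isGroup.Build IsomAdS
  isom_mulA isom_mul1g isom_mulg1 isom_mulVg isom_mulgV.

Definition nonzero : Type := set_type [set x : vec | x != 0].

HB.instance Definition _ :=
  Topological.copy nonzero (set_type [set x : vec | x != 0]).

Definition same_ray : rel nonzero :=
  fun x y => `[< exists2 t : R, 0 < t & val y = t *: val x >].

Lemma same_ray_refl : reflexive same_ray.
Proof. by move=> x; apply/asboolP; exists 1; rewrite ?scale1r. Qed.

Lemma same_ray_sym : symmetric same_ray.
Proof.
move=> x y; apply/asboolP/asboolP => -[t t0 e]; exists t^-1;
  by rewrite ?invr_gt0 // e scalerA mulVf ?scale1r // gt_eqF.
Qed.

Lemma same_ray_trans : transitive same_ray.
Proof.
move=> y x z /asboolP[t t0 exy] /asboolP[u u0 eyz]; apply/asboolP.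
by exists (u * t); [exact: mulr_gt0 | rewrite eyz exy scalerA].
Qed.

Canonical same_ray_equiv :=
  EquivRel same_ray same_ray_refl same_ray_sym same_ray_trans.

Definition proj_sphere : Type := quotient_topology {eq_quot same_ray_equiv}.

HB.instance Definition _ := Quotient.on proj_sphere.
HB.instance Definition _ := Topological.on proj_sphere.

Definition ray (x : nonzero) : proj_sphere := \pi_proj_sphere x.

(* The trace in the projective sphere of a subset of R^5. *)
Definition rays (S : set vec) : set proj_sphere := ray @` (val @^-1` S).

Definition boundary_AdS : set proj_sphere := rays [set x | q_AdS x = 0].

Definition hyperplane (H : set vec) : Prop :=
  exists2 V : {vspace vec}, (\dim V = 4)%N & H = AdS4 `&` [set` V].

Definition asymptotic (H : set vec) (p : proj_sphere) : Prop :=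
  closure (rays H) p.

Definition reflection_in (H : set vec) (r : IsomAdS) : Prop :=
  [/\ hyperplane H, r <> 1%g, (r * r = 1)%g
    & forall x, H x -> val r *m x = x].

(* Since Gamma_cube is discrete, the topology on the space of representations
   is that of pointwise convergence. *)
Definition Hom_cube : set {ptws Gamma_cube -> IsomAdS} :=
  [set rho : Gamma_cube -> IsomAdS | {morph rho : g h / (g * h)%g}].

Definition image_is_cusp_group (rho : Gamma_cube -> IsomAdS) : Prop :=
  exists H : face -> set vec,
    [/\ injective H,
        forall s, reflection_in (H s) (rho (cube_gen s))
      & exists2 p, boundary_AdS p & forall s, asymptotic (H s) p].

End AdS.

Arguments Hom_cube R : clear implicits.

(* Main.v *)
(** Six reflections in distinct hyperplanes X_s^⊥ that satisfy the commutation
    relations of the cube always form a cusp group.  Commuting reflections in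
    distinct hyperplanes have orthogonal normals.  For each k, let w_k be the
    component of X_(k,1) orthogonal to X_(k,0); it is nonzero, and the w_k are
    pairwise orthogonal vectors of the 2-dimensional orthogonal complement of
    X_(0,0), X_(1,0), X_(2,0).  In a nondegenerate plane three nonzero pairwise
    orthogonal vectors are null and collinear, so they span a null line
    orthogonal to all X_s: the common point at infinity.
    Being six distinct reflections is an open condition: an isometric involution
    of R^5 is a reflection iff its trace is 3, and the trace of an involution of
    R^5 is an odd integer. *)
Require Import Defs.
From mathcomp Require Import all_boot all_order all_algebra.
From mathcomp Require Import all_classical all_reals all_analysis.
From mathcomp Require Import ring lra.

Set Implicit Arguments.
Unset Strict Implicit.
Unset Printing Implicit Defensive.

Import Order.TTheory GRing.Theory Num.Theory.
Import numFieldNormedType.Exports.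

Local Open Scope classical_set_scope.
Local Open Scope ring_scope.

(** * The form [b_AdS] and orthogonal projections onto non-null lines *)

Section Form.
Variable R : realType.
Local Notation vec := 'cV[R]_5.
Implicit Types (x y z X Y : vec) (M : 'M[R]_5).

Lemma b_AdSC x y : b_AdS x y = b_AdS y x.
Proof. by rewrite /b_AdS; ring. Qed.

Lemma b_AdSDr x y z : b_AdS x (y + z) = b_AdS x y + b_AdS x z.
Proof. by rewrite /b_AdS /coord5 !mxE; ring. Qed.

Lemma b_AdSZr x a y : b_AdS x (a *: y) = a * b_AdS x y.
Proof. by rewrite /b_AdS /coord5 !mxE; ring. Qed.

Lemma b_AdSBr x y z : b_AdS x (y - z) = b_AdS x y - b_AdS x z.
Proof. by rewrite /b_AdS /coord5 !mxE; ring. Qed.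

Lemma b_AdSDl x y z : b_AdS (y + z) x = b_AdS y x + b_AdS z x.
Proof. by rewrite /b_AdS /coord5 !mxE; ring. Qed.

Lemma b_AdSZl x a y : b_AdS (a *: y) x = a * b_AdS y x.
Proof. by rewrite /b_AdS /coord5 !mxE; ring. Qed.

Lemma b_AdSBl x y z : b_AdS (y - z) x = b_AdS y x - b_AdS z x.
Proof. by rewrite /b_AdS /coord5 !mxE; ring. Qed.

Lemma b_AdS0r x : b_AdS x 0 = 0.
Proof. by rewrite /b_AdS /coord5 !mxE; ring. Qed.

Lemma b_AdS0l x : b_AdS 0 x = 0.
Proof. by rewrite b_AdSC b_AdS0r. Qed.

Lemma q_AdS_neq0 x : q_AdS x != 0 -> x != 0.
Proof. by apply: contra_neq => ->; rewrite /q_AdS b_AdS0r. Qed.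

Lemma q_AdSD x y : q_AdS (x + y) = q_AdS x + b_AdS x y *+ 2 + q_AdS y.
Proof. by rewrite b_AdS_polar; ring. Qed.

Lemma q_AdSZ a x : q_AdS (a *: x) = a ^+ 2 * q_AdS x.
Proof. by rewrite /q_AdS b_AdSZl b_AdSZr; ring. Qed.

(** This is [x^T J], where [J = diag(-1, 1, 1, 1, -1)] is the Gram matrix of [b_AdS]. *)
Definition dual_AdS x : 'rV[R]_5 :=
  \row_j (if (0 < j < 4)%N then x j 0 else - x j 0).

Lemma mul_dual_AdS x y : dual_AdS x *m y = (b_AdS x y)%:M.
Proof.
apply/rowP => j; rewrite [j]ord1 !mxE.
have E k : (k < 5)%N -> (inord k : 'I_5) = k :> nat by move=> ?; rewrite inordK.
rewrite !big_ord_recl big_ord0 !mxE /b_AdS /coord5 /=.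
have -> : lift ord0 ord0 = inord 1 :> 'I_5 by apply: val_inj; rewrite /= E.
have -> : lift ord0 (lift ord0 ord0) = inord 2 :> 'I_5
  by apply: val_inj; rewrite /= E.
have -> : lift ord0 (lift ord0 (lift ord0 ord0)) = inord 3 :> 'I_5
  by apply: val_inj; rewrite /= E.
have -> : lift ord0 (lift ord0 (lift ord0 (lift ord0 ord0))) = inord 4 :> 'I_5
  by apply: val_inj; rewrite /= E.
have -> : ord0 = inord 0 :> 'I_5 by apply: val_inj; rewrite /= E.
ring.
Qed.

(** The orthogonal projection onto the line of [x] if [x] is non-null; a null [x] gives [0], the
    inverse of [0] being [0]. It depends only on the line of [x], so it serves as a scale-free label
    for the hyperplane orthogonal to [x]. *)
Definition proj_AdS x : 'M[R]_5 := (q_AdS x)^-1 *: (x *m dual_AdS x).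

Lemma proj_AdSE x y : proj_AdS x *m y = (b_AdS x y / q_AdS x) *: x.
Proof.
by rewrite -scalemxAl -mulmxA mul_dual_AdS mul_mx_scalar scalerA mulrC.
Qed.

Lemma mxtrace_proj_AdS x : q_AdS x != 0 -> \tr (proj_AdS x) = 1.
Proof.
move=> qx; rewrite mxtraceZ mxtrace_mulC mul_dual_AdS mxtrace_scalar.
by rewrite mulr1n mulVf.
Qed.

Lemma proj_AdS_adj x y z :
  b_AdS (proj_AdS x *m y) z = b_AdS y (proj_AdS x *m z).
Proof. by rewrite !proj_AdSE b_AdSZl b_AdSZr (b_AdSC y); ring. Qed.

Lemma eq_mul_cV m (A B : 'M[R]_(m, 5)) :
  (forall x, A *m x = B *m x) -> A = B.
Proof.
move=> AB; apply/matrixP => i j; have /colP/(_ i) := AB (delta_mx j 0).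
by rewrite -!colE !mxE.
Qed.

Lemma proj_AdS_idem x :
  q_AdS x != 0 -> proj_AdS x *m proj_AdS x = proj_AdS x.
Proof.
move=> qx; apply: eq_mul_cV => y.
rewrite -mulmxA !proj_AdSE b_AdSZr mulfK //.
Qed.

Lemma proj_AdS_orth x y : b_AdS x y = 0 -> proj_AdS x *m proj_AdS y = 0.
Proof.
move=> xy; apply: eq_mul_cV => z.
by rewrite -mulmxA !proj_AdSE b_AdSZr xy mulr0 mul0r scale0r mul0mx.
Qed.

(** In the full-rank factorization [A = C D], cancelling [C] on the left and [D] on the right of
    [C D C D = C D] gives [D C = 1], and [tr (C D) = tr (D C)]. *)
Lemma mxtrace_idem (F : fieldType) n (A : 'M[F]_n) :
  A *m A = A -> \tr A = (\rank A)%:R.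
Proof.
move=> AA; suff DC : row_base A *m col_base A = 1%:M.
  by rewrite -{1}(mulmx_base A) mxtrace_mulC DC mxtrace1.
apply: (row_free_inj (row_base_free A)).
apply: (row_full_inj (col_base_full A)).
by rewrite mul1mx mulmx_base 2!mulmxA mulmx_base -mulmxA mulmx_base.
Qed.

(** Idempotence forces [phi u = 1], so [M] fixes [u]. Self-adjointness then gives
    [b(u, x) = phi(x) q(u)]; hence [q(u) = 0] would put [u] in the radical, and otherwise
    [phi = b(u, .) / q(u)]. *)
Lemma outer_proj_AdS u (phi : 'rV[R]_5) : (u *m phi) != 0 ->
  (u *m phi) *m (u *m phi) = u *m phi ->
  (forall x y, b_AdS (u *m phi *m x) y = b_AdS x (u *m phi *m y)) ->
  q_AdS u != 0 /\ u *m phi = proj_AdS u.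
Proof.
move=> M0 MM adj; set M := u *m phi in M0 MM adj *.
have phiu : phi *m u = 1%:M.
  apply: contra_neq_eq M0 => phiu.
  (* [M M = (phi u) M], compared with [M M = M]. *)
  have : ((phi *m u) 0 0 - 1) *: M = 0.
    rewrite scalerBl scale1r -{2}MM /M mulmxA -(mulmxA u).
    rewrite {2}[phi *m u]mx11_scalar.
    by rewrite mul_mx_scalar -scalemxAl subrr.
  move/eqP; rewrite scaler_eq0 subr_eq0 => /orP[/eqP p1|/eqP //].
  by move: phiu; rewrite [_ *m _]mx11_scalar p1 eqxx.
have Mu : M *m u = u by rewrite /M -mulmxA phiu mulmx1.
have ME x : M *m x = (phi *m x) 0 0 *: u.
  by rewrite /M -mulmxA {1}[phi *m x]mx11_scalar mul_mx_scalar.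
have bE x : b_AdS u x = (phi *m x) 0 0 * q_AdS u.
  by rewrite -{1}Mu adj ME b_AdSZr.
have qu : q_AdS u != 0.
  apply: contraNneq M0 => qu; have u0 : u = 0.
    by apply: b_AdS_nondegenerate => y; rewrite bE qu mulr0.
  by rewrite /M u0 mul0mx.
by split=> //; apply: eq_mul_cV => x; rewrite proj_AdSE ME bE mulfK.
Qed.

Lemma selfadj_idem_rank1 M : M *m M = M ->
  (forall x y, b_AdS (M *m x) y = b_AdS x (M *m y)) -> \rank M = 1%N ->
  exists2 u, q_AdS u != 0 & M = proj_AdS u.
Proof.
move=> MM adj rM.
have [u [phi ME]] : exists (u : vec) (phi : 'rV[R]_5), M = u *m phi.
  move: (mulmx_base M); move: (col_base M) (row_base M); rewrite rM => u phi <-.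
  by exists u, phi.
have M0 : M != 0 by rewrite -mxrank_eq0 rM.
rewrite ME in MM adj M0 *.
by have [qu uE] := outer_proj_AdS M0 MM adj; exists u.
Qed.

Lemma selfadj_idem_trace1 M : M *m M = M ->
  (forall x y, b_AdS (M *m x) y = b_AdS x (M *m y)) -> \tr M = 1 ->
  exists2 u, q_AdS u != 0 & M = proj_AdS u.
Proof.
move=> MM adj; rewrite mxtrace_idem // => /eqP; rewrite (eqr_nat R _ 1).
by move/eqP; exact: selfadj_idem_rank1.
Qed.

(** * Projection onto the span of an orthogonal non-null family *)

Section OrthogonalFamily.
Variables (n : nat) (v : 'I_n -> vec).
Hypothesis v_nonnull : forall i, q_AdS (v i) != 0.
Hypothesis v_orth : forall i j, i != j -> b_AdS (v i) (v j) = 0.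

Let E := \sum_i proj_AdS (v i).

Lemma sum_proj_AdS_idem : E *m E = E.
Proof.
rewrite {1}/E mulmx_suml; apply: eq_bigr => i _.
rewrite mulmx_sumr (bigD1 i) //= proj_AdS_idem // big1 ?addr0 // => j ji.
by rewrite proj_AdS_orth // v_orth // eq_sym.
Qed.

Lemma sum_proj_AdS_adj x y : b_AdS (E *m x) y = b_AdS x (E *m y).
Proof.
rewrite !mulmx_suml.
rewrite (big_morph (fun z : vec => b_AdS z y) (b_AdSDl y) (b_AdS0l y)).
rewrite (big_morph (b_AdS x) (b_AdSDr x) (b_AdS0r x)).
by apply: eq_bigr => i _; exact: proj_AdS_adj.
Qed.

Lemma mxtrace_sum_proj_AdS : \tr E = n%:R.
Proof.
rewrite raddf_sum /= (eq_bigr (fun=> 1)) => [|i _].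
  by rewrite sumr_const card_ord.
by rewrite mxtrace_proj_AdS.
Qed.

Lemma sum_proj_AdS_ortho x : (forall i, b_AdS (v i) x = 0) -> E *m x = 0.
Proof.
move=> vx; rewrite mulmx_suml big1 // => i _.
by rewrite proj_AdSE vx mul0r scale0r.
Qed.

End OrthogonalFamily.

(* Subtracting the four projections from the identity leaves a self-adjoint
   idempotent of trace 1. *)
Lemma orth4_complement (v : 'I_4 -> vec) x y :
  (forall i, q_AdS (v i) != 0) ->
  (forall i j, i != j -> b_AdS (v i) (v j) = 0) ->
  (forall i, b_AdS (v i) x = 0) -> (forall i, b_AdS (v i) y = 0) ->
  x != 0 -> y != 0 -> b_AdS x y != 0.
Proof.
move=> vq vo vx vy x0 y0; set E := \sum_i proj_AdS (v i).
have EE : E *m E = E by exact: sum_proj_AdS_idem.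
have [|a b||u qu ME] := @selfadj_idem_trace1 (1%:M - E).
- by rewrite mulmxBl mul1mx mulmxBr mulmx1 EE subrr subr0.
- by rewrite !mulmxBl !mul1mx b_AdSBl b_AdSBr sum_proj_AdS_adj.
- by rewrite raddfB /= mxtrace1 mxtrace_sum_proj_AdS // -natrB.
(* Vectors orthogonal to all [v i] are fixed by [1 - E], so they lie on the non-null line of [u],
   where nonzero vectors are never orthogonal. *)
have fixM z : (forall i, b_AdS (v i) z = 0) -> z = (b_AdS u z / q_AdS u) *: u.
  move=> vz; rewrite -proj_AdSE -ME mulmxBl mul1mx.
  by rewrite (sum_proj_AdS_ortho vz) subr0.
move: x0 y0; rewrite (fixM x vx) (fixM y vy) b_AdSZl b_AdSZr.
rewrite !scaler_eq0 !negb_or => /andP[a0 _] /andP[b0 _].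
by rewrite a0 b0.
Qed.

Lemma proj_AdSZ a x : a != 0 -> proj_AdS (a *: x) = proj_AdS x.
Proof.
move=> a0; apply: eq_mul_cV => y; rewrite !proj_AdSE q_AdSZ b_AdSZl scalerA.
have [q0|q0] := eqVneq (q_AdS x) 0.
  by rewrite q0 mulr0 invr0 !mulr0 mul0r.
by congr (_ *: _); field; rewrite a0 q0.
Qed.

Lemma common_null_orthogonal (X : face -> vec) :
  (forall s, q_AdS (X s) != 0) ->
  (forall s t, Defs.adjacent s t -> b_AdS (X s) (X t) = 0) ->
  (forall k, proj_AdS (X (k, false)) <> proj_AdS (X (k, true))) ->
  exists P, [/\ P != 0, q_AdS P = 0 & forall s, b_AdS P (X s) = 0].
Proof.
move=> Xq Xo Xd.
pose a k := X (k, false); pose c k := X (k, true).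
(* Gram-Schmidt in each pair of opposite faces. *)
pose w k := c k - proj_AdS (a k) *m c k.
have wE k : w k = c k - (b_AdS (a k) (c k) / q_AdS (a k)) *: a k.
  by rewrite /w proj_AdSE.
have Xkj k j e f : k != j -> b_AdS (X (k, e)) (X (j, f)) = 0.
  by move=> kj; exact: Xo.
have wa k j : b_AdS (w k) (a j) = 0.
  rewrite wE b_AdSBl b_AdSZl; have [->|kj] := eqVneq k j.
    by rewrite divfK ?Xq // b_AdSC subrr.
  by rewrite (Xkj k j true false kj) (Xkj k j false false kj) mulr0 subr0.
have wc k j : k != j -> b_AdS (w k) (c j) = 0.
  move=> kj.
  rewrite wE b_AdSBl b_AdSZl (Xkj k j true true kj) (Xkj k j false true kj).
  by rewrite mulr0 subr0.
have ww k j : k != j -> b_AdS (w k) (w j) = 0.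
  by move=> kj; rewrite (wE j) b_AdSBr b_AdSZr wa wc // mulr0 subr0.
(* Otherwise [c k] is a multiple of [a k] and the two projections agree. *)
have w0 k : w k != 0.
  apply/eqP; rewrite wE => /eqP; rewrite subr_eq0 => /eqP.
  move: (_ / _) => l ck.
  apply: (Xd k); rewrite -/(a k) -/(c k) ck proj_AdSZ //.
  have := q_AdS_neq0 (Xq (k, true)); rewrite -/(c k) ck scaler_eq0.
  by rewrite negb_or => /andP[].
exists (w 0); suff qw : q_AdS (w 0) = 0.
  split=> // -[k [|]]; last exact: wa.
  (* For [k = 0], [c 0] is [w 0] plus a multiple of [a 0], so its pairing with [w 0] is
     [q (w 0) = 0]. *)
  have [->|k0] := eqVneq k 0; last by rewrite wc // eq_sym.
  rewrite -[X _](subrK (proj_AdS (a 0) *m c 0)) b_AdSDr proj_AdSE b_AdSZr wa.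
  by rewrite mulr0 addr0 -proj_AdSE.
(* If [w 0] were non-null, then [w 0, a 0, a 1, a 2] would be an orthogonal non-null family, and the
   remaining two [w k] would be nonzero, orthogonal to it and to each other, against
   [orth4_complement]. *)
apply/eqP; apply: contraT => qw.
pose v (i : 'I_4) := if unlift ord0 i is Some k then a k else w 0.
have vx k : k != 0 -> forall i, b_AdS (v i) (w k) = 0.
  move=> k0 i; rewrite /v; case: unliftP => [j _|_]; first by rewrite b_AdSC.
  by rewrite ww // eq_sym.
have := @orth4_complement v (w 1) (w (lift ord0 1)) _ _
  (vx _ _) (vx _ _) (w0 _) (w0 _).
rewrite ww // eqxx; apply=> // [i|i j]; rewrite /v.
  by case: unliftP => // j _; exact: Xq.
case: unliftP => [k ->|->]; case: unliftP => [l ->|->] //.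
- by rewrite (inj_eq lift_inj) => kl; exact: Xo.
- by rewrite b_AdSC.
Qed.

End Form.

(** * Reflections, their normals and their hyperplanes *)

Section Reflections.
Variable R : realType.
Local Notation vec := 'cV[R]_5.
Implicit Types (x y z X Y P : vec) (A M : 'M[R]_5) (V : {vspace vec}).
Implicit Types (H : set vec) (r : IsomAdS R).

Lemma O_AdS_b A x y : O_AdS A -> b_AdS (A *m x) (A *m y) = b_AdS x y.
Proof.
move=> OA; apply: (mulIf (x := 2%:R)); first by rewrite pnatr_eq0.
by rewrite !mulr_natr !b_AdS_polar -mulmxDr !OA.
Qed.

(** [(1 - A) / 2] is the projection onto the [-1]-eigenspace of the involution [A]. *)
Lemma half_sub_idem A : A *m A = 1%:M ->
  (2^-1 *: (1%:M - A)) *m (2^-1 *: (1%:M - A)) = 2^-1 *: (1%:M - A).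
Proof.
move=> AA; rewrite -scalemxAl -scalemxAr scalerA.
rewrite mulmxBl mul1mx mulmxBr mulmx1 AA.
by apply/matrixP => i j; rewrite !mxE; field.
Qed.

Lemma half_sub_adj A x y : O_AdS A -> A *m A = 1%:M ->
  b_AdS (2^-1 *: (1%:M - A) *m x) y = b_AdS x (2^-1 *: (1%:M - A) *m y).
Proof.
move=> OA AA; rewrite -!scalemxAl b_AdSZl b_AdSZr !mulmxBl !mul1mx.
by rewrite b_AdSBl b_AdSBr -(O_AdS_b x (A *m y) OA) mulmxA AA mul1mx.
Qed.

Lemma half_subE A M : 2^-1 *: (1%:M - A) = M -> A = 1%:M - 2 *: M.
Proof.
by move=> <-; apply/matrixP => i j; rewrite !mxE; field.
Qed.

(** A basis of [V], written as the rows of [B], has rank 4 and satisfies [M B^T = 0], so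
    [rank M + 4 <= 5]. *)
Lemma hyperplane_rank V M : \dim V = 4%N -> M != 0 ->
  (forall x, x \in V -> M *m x = 0) -> \rank M = 1%N.
Proof.
move=> V4 M0 MV; pose B : 'M[R]_(\dim V, 5) :=
  \matrix_(i < \dim V) (nth 0 (vbasis V) i)^T.
have rB : row_free B.
  apply: inj_row_free => v vB.
  have /freeP fV := basis_free (vbasisP V); apply/rowP => i; rewrite mxE.
  apply: fV; apply: trmx_inj; rewrite trmx0 -[RHS]vB mulmx_sum_row.
  by rewrite raddf_sum /=; apply: eq_bigr => j _; rewrite rowK linearZ.
have MB : M *m B^T = 0.
  apply: trmx_inj; rewrite trmx_mul trmxK trmx0; apply/row_matrixP => i.
  rewrite row_mul row0 rowK -trmx_mul MV ?trmx0 //.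
  by apply: vbasis_mem; apply: mem_nth; rewrite size_tuple.
have := mulmx0_rank_max MB; rewrite mxrank_tr (eqP rB) V4 addnC.
by move: M0; rewrite -mxrank_eq0; case: (\rank M) => [|[|n]] //.
Qed.

Lemma proj_AdS_eq0 X x : q_AdS X != 0 ->
  (proj_AdS X *m x == 0) = (b_AdS X x == 0).
Proof.
move=> qX; rewrite proj_AdSE scaler_eq0 (negbTE (q_AdS_neq0 qX)) orbF.
by rewrite mulf_eq0 invr_eq0 (negbTE qX) orbF.
Qed.

Lemma dim_fullv_cV n : \dim {: 'cV[R]_n} = n.
Proof. by rewrite dimvf dim_matrix; exact: muln1. Qed.

(** The orthogonal of [X] when [X] is non-null; as a kernel, it gets its dimension from
    rank-nullity. *)
Definition orthov X : {vspace vec} :=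
  lker (linfun (mulmx (proj_AdS X) : vec -> vec)).

Lemma mem_orthov X x : q_AdS X != 0 -> (x \in orthov X) = (b_AdS X x == 0).
Proof. by move=> qX; rewrite memv_ker lfunE /= proj_AdS_eq0. Qed.

Lemma dim_orthov X : q_AdS X != 0 -> \dim (orthov X) = 4%N.
Proof.
move=> qX; set f := linfun (mulmx (proj_AdS X) : vec -> vec).
have := limg_ker_dim f fullv; rewrite capfv dim_fullv_cV.
suff -> : limg f = <[X]>%VS by rewrite dim_vline q_AdS_neq0 // addn1 => -[].
apply/eqP; rewrite eqEsubv; apply/andP; split.
  apply/subvP => _ /memv_imgP[x _ ->]; rewrite lfunE /= proj_AdSE.
  by rewrite memvZ // memv_line.
rewrite -memvE; apply/memv_imgP; exists X; first exact: memvf.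
by rewrite lfunE /= proj_AdSE divff // scale1r.
Qed.

Lemma hyperplane_ortho V X : \dim V = 4%N -> q_AdS X != 0 ->
  (forall x, x \in V -> b_AdS X x = 0) -> V = orthov X.
Proof.
move=> V4 qX VX; apply/eqP; rewrite eqEdim V4 dim_orthov // leqnn andbT.
by apply/subvP => x /VX bx; rewrite mem_orthov // bx.
Qed.

(* A hyperplane meets the negative definite plane spanned by the coordinate
   vectors 0 and 4. *)
Lemma hyperplane_negative V : \dim V = 4%N ->
  exists2 n, n \in V & q_AdS n < 0.
Proof.
move=> V4.
(* [f] keeps coordinates 1, 2, 3; its kernel is the negative definite plane, and a 4-dimensional [V]
   cannot inject into dimension 3. *)
pose f : 'Hom(vec, 'cV[R]_3) :=
  linfun (mulmx (\matrix_(i < 3, j < 5) (j == i.+1 :> nat)%:R)).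
have lt5 (i : 'I_3) : (i.+1 < 5)%N by case: i => [[|[|[|]]]].
have fE x i : f x i 0 = x (inord i.+1) 0.
  rewrite lfunE /= !mxE (bigD1 (inord i.+1)) //= mxE inordK ?eqxx //.
  rewrite mul1r big1 ?addr0 // => j jn; rewrite mxE.
  case: eqP => [ji|]; last by rewrite mul0r.
  by case/eqP: jn; apply: val_inj; rewrite /= inordK ?ji.
have : (V :&: lker f)%VS != 0%VS.
  rewrite -dimv_eq0; have := limg_ker_dim f V; rewrite V4.
  have := dimvS (subvf (f @: V)%VS); rewrite dim_fullv_cV.
  by move=> d3 dE; apply: contraTneq d3 => d0; move: dE; rewrite d0 add0n => ->.
rewrite -vpick0; set n := vpick _ => n0.
have /memv_capP[nV nf] : n \in (V :&: lker f)%VS by exact: memv_pick.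
exists n => //; move: nf; rewrite memv_ker => /eqP fn.
have c k : (k < 3)%N -> n (inord k.+1) 0 = 0.
  by move=> k3; rewrite -(fE n (Ordinal k3)) fn mxE.
rewrite /q_AdS /b_AdS /coord5 (c 0%N) // (c 1%N) // (c 2%N) //.
rewrite !mulr0 !addr0 -opprD oppr_lt0 -!expr2 lt0r.
rewrite addr_ge0 ?sqr_ge0 // andbT paddr_eq0 ?sqr_ge0 // !sqrf_eq0.
apply: contraNN n0 => /andP[/eqP n00 /eqP n40].
apply/eqP/colP => i; rewrite mxE -(inord_val i).
by case: (nat_of_ord i) (ltn_ord i) => [|[|[|[|[|]]]]] //= _; exact: c.
Qed.

(** The points of [AdS4] in [V] span [V]: negative vectors rescale into [AdS4], and
    [x = (x + t n) - t n] with [n] negative and [t] large. *)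
Lemma hyperplane_ext V m (A : 'M[R]_(m, 5)) : \dim V = 4%N ->
  (forall x, (@AdS4 R `&` [set` V]) x -> A *m x = 0) ->
  forall x, x \in V -> A *m x = 0.
Proof.
move=> V4 AV.
have Aneg x : x \in V -> q_AdS x < 0 -> A *m x = 0.
  move=> xV qx; pose s := Num.sqrt (- q_AdS x).
  have s0 : 0 < s by rewrite sqrtr_gt0 oppr_gt0.
  have /eqP : A *m (s^-1 *: x) = 0.
    apply: AV; split; last by rewrite /= memvZ.
    rewrite /AdS4 /= q_AdSZ exprVn sqr_sqrtr ?oppr_ge0 ?ltW //.
    by rewrite invrN mulNr mulVf // lt_eqF.
  by rewrite -scalemxAr scaler_eq0 invr_eq0 gt_eqF //= => /eqP.
have [n nV qn] := hyperplane_negative V4 => x xV.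
have [t t0 qt] : exists2 t : R, t != 0 & q_AdS (x + t *: n) < 0.
  (* If [t >= 1] and [t q(n) <= - c], then [q(x) + 2 t b(x, n) <= t (c - 1)], whence
     [q(x + t n) <= - t < 0]. *)
  pose c := `|q_AdS x| + 2 * `|b_AdS x n| + 1.
  have c1 : 1 <= c.
    rewrite /c; have := normr_ge0 (q_AdS x).
    by have := normr_ge0 (b_AdS x n); lra.
  exists (c / - q_AdS n + 1).
    by rewrite gt_eqF // ltr_wpDl // divr_ge0 //; lra.
  rewrite q_AdSD q_AdSZ b_AdSZr.
  set t := _ + 1.
  have t1 : 1 <= t by rewrite /t lerDr divr_ge0 //; lra.
  have tq : t * q_AdS n <= - c.
    rewrite /t mulrDl mul1r invrN mulrN mulNr divfK ?lt_eqF //; lra.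
  have := ler_norm (q_AdS x); have := ler_norm (b_AdS x n).
  have := normr_ge0 (q_AdS x); have := normr_ge0 (b_AdS x n).
  move: tq; rewrite /c; nra.
have := Aneg _ (memvD xV (memvZ t nV)) qt.
by rewrite mulmxDr -scalemxAr (Aneg n) // scaler0 addr0.
Qed.

(** [(1 - r) / 2] is a nonzero self-adjoint idempotent that kills [V] by [hyperplane_ext]; it has
    rank 1 and projects onto the normal [X]. *)
Lemma reflection_inP H r : reflection_in H r ->
  exists X, [/\ q_AdS X != 0, val r = 1%:M - 2 *: proj_AdS X &
                H = @AdS4 R `&` [set x | b_AdS X x = 0]].
Proof.
move=> [[V V4 ->] r1 /(congr1 val) /= rr fixH].
have Or : O_AdS (val r) := set_valP r.
pose M := 2^-1 *: (1%:M - val r).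
have MV x : x \in V -> M *m x = 0.
  apply: hyperplane_ext => // y /fixH ry.
  by rewrite -scalemxAl mulmxBl mul1mx ry subrr scaler0.
have M0 : M != 0.
  rewrite scaler_eq0 invr_eq0 pnatr_eq0 /= subr_eq0.
  by apply/eqP => r1'; apply: r1; apply: val_inj.
have [X qX MX] := selfadj_idem_rank1 (half_sub_idem rr)
  (fun x y => half_sub_adj x y Or rr) (hyperplane_rank V4 M0 MV).
exists X; split=> //; first exact: half_subE.
have -> : V = orthov X.
  apply: hyperplane_ortho => // x /MV/eqP.
  by rewrite /M MX proj_AdS_eq0 // => /eqP.
by congr (_ `&` _); apply/seteqP; split=> x /=; rewrite mem_orthov // => /eqP.
Qed.

(** By [hyperplane_ext], [b(X, .)] vanishes on the whole orthogonal of [Y], so it is a multiple of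
    [b(Y, .)]; nondegeneracy makes [X] and [Y] proportional. *)
Lemma orth_hyperplane_inj X Y : q_AdS X != 0 -> q_AdS Y != 0 ->
  @AdS4 R `&` [set x | b_AdS X x = 0] = @AdS4 R `&` [set x | b_AdS Y x = 0] ->
  proj_AdS X = proj_AdS Y.
Proof.
move=> qX qY XY; have YX x : x \in orthov Y -> dual_AdS X *m x = 0.
  apply: hyperplane_ext; first exact: dim_orthov.
  move=> z [zA] /=; rewrite mem_orthov // => /eqP Yz.
  have [_ /= Xz] : (@AdS4 R `&` [set x | b_AdS X x = 0]) z by rewrite XY.
  by rewrite mul_dual_AdS Xz raddf0.
have bX y : b_AdS X y = b_AdS X Y / q_AdS Y * b_AdS Y y.
  have /YX/rowP/(_ 0) : y - proj_AdS Y *m y \in orthov Y.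
    by rewrite mem_orthov // b_AdSBr proj_AdSE b_AdSZr divfK // subrr.
  rewrite mul_dual_AdS !mxE eqxx mulr1n b_AdSBr proj_AdSE b_AdSZr.
  move=> /subr0_eq ->.
  by ring.
have XE : X = (b_AdS X Y / q_AdS Y) *: Y.
  apply/eqP; rewrite -subr_eq0; apply/eqP; apply: b_AdS_nondegenerate => y.
  by rewrite b_AdSBl b_AdSZl bX subrr.
have := q_AdS_neq0 qX; rewrite XE; move: (_ / _) => l.
by rewrite scaler_eq0 negb_or => /andP[l0 _]; rewrite proj_AdSZ.
Qed.

(** The projection [(1 - A) / 2] has rank [(5 - tr A) / 2], an integer strictly between 1/2 and
    3/2. *)
Lemma reflection_near_trace A : O_AdS A -> A *m A = 1%:M -> 2 < \tr A < 4 ->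
  exists2 X, q_AdS X != 0 & A = 1%:M - 2 *: proj_AdS X.
Proof.
move=> OA AA trA; have [||X qX MX] := selfadj_idem_rank1 (half_sub_idem AA).
- by move=> x y; exact: half_sub_adj.
- have := mxtrace_idem (half_sub_idem AA).
  rewrite mxtraceZ raddfB /= mxtrace1; case: (\rank _) => [|[|n]] //.
    by move=> E; exfalso; move: E trA => ? /andP[]; lra.
  by rewrite -[n.+2]addn2 natrD => E; exfalso;
    move: E (ler0n R n) trA => ? ? /andP[]; lra.
by exists X => //; exact: half_subE.
Qed.

Lemma proj_AdS_reflection_in r X : q_AdS X != 0 -> (r * r = 1)%g ->
  val r = 1%:M - 2 *: proj_AdS X ->
  reflection_in (@AdS4 R `&` [set x | b_AdS X x = 0]) r.
Proof.
move=> qX rr rE; split=> //.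
- exists (orthov X); first exact: dim_orthov.
  by congr (_ `&` _); apply/seteqP; split=> x /=; rewrite mem_orthov // => /eqP.
- move=> /(congr1 val) /= /eqP.
  rewrite rE -subr_eq0 addrAC subrr add0r oppr_eq0 scaler_eq0 pnatr_eq0 /=.
  move=> /eqP p0.
  have := mxtrace_proj_AdS qX; rewrite p0 mxtrace0 => /esym/eqP.
  by rewrite oner_eq0.
- move=> x [_ /= Xx]; rewrite rE mulmxBl mul1mx -scalemxAl proj_AdSE Xx.
  by rewrite mul0r scale0r scaler0 subr0.
Qed.

(** The projections commute as well. Evaluating both products at [Y] gives
    [b(X, Y) X = b(X, Y) proj_Y(X)] up to a nonzero factor, so [b(X, Y) != 0] would put [X] on the
    line of [Y]. *)
Lemma commuting_reflections_orth X Y : q_AdS X != 0 -> q_AdS Y != 0 ->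
  (1%:M - 2 *: proj_AdS X) *m (1%:M - 2 *: proj_AdS Y) =
  (1%:M - 2 *: proj_AdS Y) *m (1%:M - 2 *: proj_AdS X) ->
  proj_AdS X <> proj_AdS Y -> b_AdS X Y = 0.
Proof.
move=> qX qY XY XnY.
have PQ : proj_AdS X *m proj_AdS Y = proj_AdS Y *m proj_AdS X.
  move: XY; rewrite !mulmxBl !mul1mx !mulmxBr !mulmx1 -!scalemxAl -!scalemxAr.
  move: (_ *m _) (_ *m _) => U W /matrixP UW.
  by apply/matrixP => i j; have := UW i j; rewrite !mxE; lra.
apply/eqP; apply: contra_notT XnY => XY0.
have YY : proj_AdS Y *m Y = Y by rewrite proj_AdSE divff // scale1r.
have := congr1 (fun M => M *m Y) PQ; rewrite /= -!mulmxA YY (proj_AdSE X Y).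
rewrite -scalemxAr => /scalerI -/(_ (mulf_neq0 XY0 (invr_neq0 qX))).
rewrite proj_AdSE b_AdSC => XE.
by rewrite XE proj_AdSZ // mulf_neq0 ?invr_neq0.
Qed.

End Reflections.

(** * Null directions as asymptotic points of hyperplanes *)

Section Asymptotic.
Variable R : realType.
Local Notation vec := 'cV[R]_5.

Lemma rays_AdS4 (V : set vec) (x : nonzero R) :
  (forall t y, V y -> V (t *: y)) -> V (val x) -> q_AdS (val x) < 0 ->
  rays (@AdS4 R `&` V) (ray x).
Proof.
move=> Vcone Vx qx; pose s := Num.sqrt (- q_AdS (val x)).
have s0 : 0 < s by rewrite sqrtr_gt0 oppr_gt0.
have yn0 : [set y : vec | y != 0] (s^-1 *: val x).
  rewrite /= scaler_eq0 invr_eq0 gt_eqF //=; exact: set_valP x.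
exists (SigSub (mem_set yn0)) => /=.
  split; last exact: Vcone.
  rewrite /AdS4 /= q_AdSZ exprVn sqr_sqrtr ?oppr_ge0 ?ltW //.
  by rewrite invrN mulNr mulVf // lt_eqF.
apply/eqmodP/asboolP; exists s => //=.
by rewrite scalerA mulfV ?scale1r // gt_eqF.
Qed.

(** The ray of [P] is approached along [P + e w] with [e > 0] tending to 0, where [w] is orthogonal
    to [X] and [b(P, w) < 0]: then [q(P + e w) = 2 e b(P, w) + e^2 q(w)] is negative for small
    [e]. *)
Lemma asymptotic_ortho (X P : vec) (P0 : [set x : vec | x != 0] P) :
  q_AdS X != 0 -> q_AdS P = 0 -> b_AdS P X = 0 ->
  asymptotic (@AdS4 R `&` [set x | b_AdS X x = 0]) (ray (SigSub (mem_set P0))).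
Proof.
move=> qX qP PX.
have [y Py] : exists y, b_AdS P y != 0.
  apply: contrapT => /forallNP nP; move: (P0) => /= /eqP; apply.
  by apply: b_AdS_nondegenerate => y; apply/eqP; apply: contrapT => /negP /nP.
(* Removing the [X]-component keeps [b(P, y)], and the scalar makes [b(P, w) = - b(P, y)^2]. *)
pose w := - b_AdS P y *: (y - proj_AdS X *m y).
have Xw : b_AdS X w = 0.
  by rewrite /w b_AdSZr b_AdSBr proj_AdSE b_AdSZr divfK // subrr mulr0.
have Pw : b_AdS P w < 0.
  rewrite /w b_AdSZr b_AdSBr proj_AdSE b_AdSZr PX mulr0 subr0 mulNr oppr_lt0.
  by rewrite -expr2 exprn_even_gt0.
have curve : (P + e *: w) @[e --> (0 : R)^'+] --> P.
  have E : P = P + 0 *: w by rewrite scale0r addr0.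
  rewrite [X in _ --> X]E.
  apply: cvgD; first exact: cvg_cst.
  by apply: cvgZr_tmp; exact: cvg_within.
(* A neighbourhood of the ray pulls back to an open set [W'] of vectors around [P]. *)
move=> U /pi_continuous [W [[W' oW' W'E] WP WU]].
have PW' : nbhs P W'.
  by apply: open_nbhs_nbhs; split=> //; move: WP; rewrite -W'E.
near (0 : R)^'+ => e.
have e0 : 0 < e by near: e; exact: nbhs_right_gt.
have W'e : W' (P + e *: w) by near: e; exact: curve.
have qe : q_AdS (P + e *: w) < 0.
  rewrite q_AdSD q_AdSZ b_AdSZr qP add0r.
  have : e < - b_AdS P w / (`|q_AdS w| + 1).
    by near: e; apply: nbhs_right_lt; rewrite divr_gt0 ?oppr_gt0 // ltr_wpDl.
  rewrite ltr_pdivlMr ?ltr_wpDl // => eb.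
  have : e * q_AdS w <= e * `|q_AdS w| by rewrite ler_pM2l // ler_norm.
  move=> ee; have -> : e * b_AdS P w *+ 2 + e ^+ 2 * q_AdS w =
    e * (b_AdS P w *+ 2 + e * q_AdS w) by ring.
  by rewrite pmulr_rlt0 //; lra.
have x0 : [set x : vec | x != 0] (P + e *: w).
  exact: q_AdS_neq0 (ltr0_neq0 qe).
pose x : nonzero R := SigSub (mem_set x0).
exists (ray x); split.
  apply: rays_AdS4 => //= [t z Xz|]; first by rewrite b_AdSZr Xz mulr0.
  by rewrite b_AdSDr b_AdSZr Xw b_AdSC PX mulr0 addr0.
by apply: WU; rewrite -W'E.
Unshelve. all: by end_near.
Qed.

End Asymptotic.

(** * Continuity of evaluation, and open conditions on matrices *)

Section Openness.
Variable R : realType.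

Lemma eval_Hom_continuous (g : Gamma_cube) :
  continuous (fun rho : set_type (Hom_cube R) => val (set_val rho g) : 'M[R]_5).
Proof.
move=> rho; apply: (@continuous_comp _ (IsomAdS R) _
  (fun f : set_type (Hom_cube R) => set_val f g) val);
  last exact: initial_continuous.
apply: (@continuous_comp _ {ptws Gamma_cube -> IsomAdS R} _
  set_val (fun f => f g)); first exact: initial_continuous.
exact: proj_continuous.
Qed.

Lemma mxtrace_continuous n : continuous (fun A : 'M[R]_n.+1 => \tr A).
Proof.
move=> A; rewrite /mxtrace.
apply: (cvg_big add_continuous (nbhs_filter A)) => i _.
exact: coord_continuous.
Qed.

(** Some entry of [f - g] is nonzero at [x] and stays nonzero nearby. *)
Lemma near_neq_mx (T : topologicalType) m n (f g : T -> 'M[R]_(m.+1, n.+1)) x :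
  {for x, continuous f} -> {for x, continuous g} -> f x != g x ->
  \forall y \near x, f y != g y.
Proof.
move=> cf cg fg; have [i [j fgij]] : exists i j, f x i j - g x i j != 0.
  apply: contrapT => /forallNP E; move/eqP: fg; apply; apply/matrixP => i j.
  by apply/eqP; move/forallNP: (E i) => /(_ j)/negP; rewrite negbK subr_eq0.
have : (f y i j - g y i j) @[y --> x] --> f x i j - g x i j.
  apply: cvgB.
    apply: (cvg_comp f (fun A => A i j)); first exact: cf.
    exact: coord_continuous.
  apply: (cvg_comp g (fun A => A i j)); first exact: cg.
    exact: coord_continuous.
move=> /cvgr_neq0 /(_ fgij); apply: filterS => y.
by apply: contraNneq => ->; rewrite subrr.
Qed.

End Openness.

(** * Representations of the cube group *)

Section Representations.
Variables (R : realType) (rho : Gamma_cube -> IsomAdS R).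
Hypothesis rhoM : {morph rho : g h / (g * h)%g}.

Lemma rho_gen_square s : (rho (cube_gen s) * rho (cube_gen s) = 1)%g.
Proof.
have rho1 : rho 1%g = 1%g.
  by apply: (mulgI (rho 1%g)); rewrite -rhoM !mulg1.
rewrite -rhoM -rho1; congr rho; rewrite [LHS]cube_wordM.
by apply/cube_wordP; exact: cube_congr_square.
Qed.

Lemma rho_gen_comm s t : Defs.adjacent s t ->
  (rho (cube_gen s) * rho (cube_gen t) = rho (cube_gen t) * rho (cube_gen s))%g.
Proof.
move=> st; rewrite -!rhoM; congr rho; rewrite [LHS]cube_wordM [RHS]cube_wordM.
by apply/cube_wordP; exact: cube_congr_comm.
Qed.

(** Both hypotheses are open conditions; the common point at infinity comes from the commutation
    relations through [common_null_orthogonal]. *)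
Lemma distinct_reflections_cusp_group :
  (forall s, 2 < \tr (val (rho (cube_gen s))) < 4) ->
  (forall s t, s != t -> val (rho (cube_gen s)) != val (rho (cube_gen t))) ->
  image_is_cusp_group rho.
Proof.
move=> tr_rho dist_rho.
have [X XP] : {X : face -> 'cV[R]_5 & forall s, q_AdS (X s) != 0 /\
    val (rho (cube_gen s)) = 1%:M - 2 *: proj_AdS (X s)}.
  apply: (@choice _ _ (fun s Y => q_AdS Y != 0 /\
    val (rho (cube_gen s)) = 1%:M - 2 *: proj_AdS Y)) => s.
  have [|Y qY rY] :=
    reflection_near_trace (set_valP (rho (cube_gen s))) _ (tr_rho s).
    exact: (congr1 val (rho_gen_square s)).
  by exists Y.
have qX s : q_AdS (X s) != 0 by have [] := XP s.
have rX s : val (rho (cube_gen s)) = 1%:M - 2 *: proj_AdS (X s).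
  by have [] := XP s.
have XI s t : proj_AdS (X s) = proj_AdS (X t) -> s = t.
  move=> st; apply/eqP; apply: contraT => /dist_rho.
  by rewrite !rX st eqxx.
have [P [P0 qP PX]] : exists P, [/\ P != 0, q_AdS P = 0 &
    forall s, b_AdS P (X s) = 0].
  apply: common_null_orthogonal => // [s t st|k /XI //].
  apply: commuting_reflections_orth => // [|/XI ts].
    by rewrite -!rX; exact: (congr1 val (rho_gen_comm st)).
  by move: st; rewrite /Defs.adjacent ts eqxx.
exists (fun s => @AdS4 R `&` [set x | b_AdS (X s) x = 0]); split.
- by move=> s t /orth_hyperplane_inj st; apply: XI; exact: st.
- by move=> s; apply: proj_AdS_reflection_in => //; exact: rho_gen_square.
- pose P' : nonzero R := SigSub (mem_set (P0 : [set x | x != 0] P)).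
  exists (ray P'); first by exists P'.
  by move=> s; exact: asymptotic_ortho.
Qed.

End Representations.

(** * Stability of cusp groups under deformation *)

Theorem proposition3p15 (R : realType) (rho : set_type (Hom_cube R)) :
  image_is_cusp_group (set_val rho) ->
  \forall rho' \near rho, image_is_cusp_group (set_val rho').
Proof.
move=> [H [H_inj H_refl _]].
have near_tr : \forall rho' \near rho, forall s : 'I_3 * bool,
    2 < \tr (val (set_val rho' (cube_gen s))) < 4.
  (* There are finitely many faces, so one neighbourhood serves them all. *)
  apply: (@filter_forall _ ('I_3 * bool)%type _ (nbhs rho)) => s.
  have [X [qX rX _]] := reflection_inP (H_refl s).
  have tr3 : \tr (val (set_val rho (cube_gen s))) = 3.
    rewrite rX raddfB /= mxtrace1 mxtraceZ mxtrace_proj_AdS //; lra.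
  have tr_cvg :
      \tr (val (set_val rho' (cube_gen s))) @[rho' --> rho] --> (3 : R).
    rewrite -tr3.
    apply: (cvg_comp (fun f : set_type (Hom_cube R) =>
      val (set_val f (cube_gen s)) : 'M[R]_5) (fun A => \tr A)).
      exact: eval_Hom_continuous.
    exact: mxtrace_continuous.
  near=> rho'; apply/andP; split; near: rho'.
    by apply: (cvgr_gt _ tr_cvg); lra.
  by apply: (cvgr_lt _ tr_cvg); lra.
have near_neq : \forall rho' \near rho, forall s : 'I_3 * bool,
    forall t : 'I_3 * bool, s != t ->
    val (set_val rho' (cube_gen s)) != val (set_val rho' (cube_gen t)).
  apply: (@filter_forall _ ('I_3 * bool)%type _ (nbhs rho)) => s.
  apply: (@filter_forall _ ('I_3 * bool)%type _ (nbhs rho)) => t.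
  have [-> |st] := eqVneq s t; first by near=> rho'.
  have neq : val (set_val rho (cube_gen s)) != val (set_val rho (cube_gen t)).
    (* Equal reflections have equal projections, hence equal hyperplanes. *)
    apply: contra_neq st => rst; apply: H_inj.
    have [X [qX rX ->]] := reflection_inP (H_refl s).
    have [Y [qY rY ->]] := reflection_inP (H_refl t).
    have : proj_AdS X = proj_AdS Y.
      move: rst; rewrite rX rY => /addrI/oppr_inj/scalerI; apply.
      by rewrite pnatr_eq0.
    move=> XY; congr (_ `&` _); apply/seteqP; split=> x /= /eqP.
      by rewrite -proj_AdS_eq0 // XY proj_AdS_eq0 // => /eqP.
    by rewrite -proj_AdS_eq0 // -XY proj_AdS_eq0 // => /eqP.
  have := near_neq_mx (@eval_Hom_continuous R _ rho)
    (@eval_Hom_continuous R _ rho) neq.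
  exact: filterS.
near=> rho'; apply: distinct_reflections_cusp_group.
- exact: (set_valP rho').
- by near: rho'.
- by near: rho'.
Unshelve. all: by end_near.
Qed.
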